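(* Let $\varphi\colon\mathbb{R}^n\to\overline{\mathbb{R}}$, and let $\bar v\in\partial_p\varphi(\bar x)$ with $\bar x\in\operatorname{dom}\varphi$. The following assertions hold: (i) The second subderivative $\mathrm{d}^2\varphi(\bar x,\bar v)$ is a lower semicontinuous function such that, for some $r>0$, $\mathrm{d}^2\varphi(\bar x,\bar v)(w)\ge -r\|w\|^2$ for all $w\in\mathbb{R}^n$. In particular, the function $\mathrm{d}^2\varphi(\bar x,\bar v)$ is proper. (ii) If, with $\bar z:=(\bar x,\varphi(\bar x))$ and $q_w:=(w,\mathrm{d}\varphi(\bar x)(w))$, we have $T^2_{\operatorname{epi}\varphi}(\bar z,q_w)\ne\emptyset$ for all $w\in\mathbb{R}^n$ satisfying $\mathrm{d}\varphi(\bar x)(w)=\langle\bar v,w\rangle$, then $$\operatorname{dom}\mathrm{d}^2\varphi(\bar x,\bar v)=\big\{w\in\mathbb{R}^n\mid\mathrm{d}\varphi(\bar x)(w)=\langle\bar v,w\rangle\big\}.$$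
   Context: $\overline{\mathbb{R}}:=(-\infty,\infty]$, $\operatorname{dom}\varphi:=\{x\mid\varphi(x)<\infty\}$, $\operatorname{epi}\varphi:=\{(x,\alpha)\mid\alpha\ge\varphi(x)\}$. A function with values in $[-\infty,\infty]$ is proper if it never takes the value $-\infty$ and has nonempty domain. Proximal subdifferential: $\bar v\in\partial_p\varphi(\bar x)$ if there are $\gamma,r>0$ with $\varphi(x)\ge\varphi(\bar x)+\langle\bar v,x-\bar x\rangle-\frac r2\|x-\bar x\|^2$ for all $x$ with $\|x-\bar x\|\le\gamma$. Subderivative: $\mathrm{d}\varphi(\bar x)(\bar w):=\liminf_{t\downarrow 0,\,w\to\bar w}\frac{\varphi(\bar x+tw)-\varphi(\bar x)}{t}$. Second subderivative: $\mathrm{d}^2\varphi(\bar x,\bar v)(w):=\liminf_{t\downarrow0,\,u\to w}\frac{\varphi(\bar x+tu)-\varphi(\bar x)-t\langle\bar v,u\rangle}{\frac12t^2}$. Second-order tangent set to $\Omega$ at $\bar x\in\Omega$ for a tangent vector $w$: $T^2_\Omega(\bar x,w):=\{u\mid\exists\,t_k\downarrow0,\ u_k\to u\text{ with }\bar x+t_kw+\frac12t_k^2u_k\in\Omega\}$. *)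

(* Defs.v *)
(* Written in MathComp-Analysis; the real line is an arbitrary [R : realType]. *)
From HB Require Import structures.
From mathcomp Require Import all_boot all_order all_algebra.
From mathcomp Require Import all_classical all_reals all_analysis.

Set Implicit Arguments.
Unset Strict Implicit.
Unset Printing Implicit Defensive.

Import Order.TTheory GRing.Theory Num.Theory.
Import numFieldNormedType.Exports.

Local Open Scope classical_set_scope.
Local Open Scope ring_scope.

(* The norm [`|x|] of a row vector is the sup norm in the library, which gives
   the usual topology of R^n but not the Euclidean length, hence [enorm]. *)
Definition dot {R : realType} {n : nat} (u v : 'rV[R]_n) : R :=
  \sum_(i < n) u 0 i * v 0 i.

Definition enorm {R : realType} {n : nat} (u : 'rV[R]_n) : R :=
  Num.sqrt (dot u u).

Definition edom {R : realType} {T : Type} (f : T -> \bar R) : set T :=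
  [set x | (f x < +oo)%E].

Definition epigraph {R : realType} {T : Type} (f : T -> \bar R) :
    set (T * R) :=
  [set p | (f p.1 <= p.2%:E)%E].

Definition eproper {R : realType} {T : Type} (f : T -> \bar R) : Prop :=
  (forall x, f x != -oo%E) /\ edom f !=set0.

Definition proximal_subdifferential {R : realType} {n : nat}
    (phi : 'rV[R]_n -> \bar R) (x : 'rV[R]_n) : set 'rV[R]_n :=
  [set v | exists gamma r : R, [/\ 0 < gamma, 0 < r &
    forall y, enorm (y - x) <= gamma ->
      (phi x + (dot v (y - x) - r / 2 * enorm (y - x) ^+ 2)%:E <= phi y)%E]].

(* In both difference quotients the scalar factor is a positive real along the
   filter, so the quotient is [+oo] exactly where the increment of [phi] is. *)
Definition subderivative {R : realType} {n : nat}
    (phi : 'rV[R]_n -> \bar R) (x w : 'rV[R]_n) : \bar R :=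
  limf_einf
    (fun p : R * 'rV[R]_n => (phi (x + p.1 *: p.2)%R - phi x) * (p.1^-1)%:E)%E
    (filter_prod (0 : R)^'+ (nbhs w)).

Definition second_subderivative {R : realType} {n : nat}
    (phi : 'rV[R]_n -> \bar R) (x v w : 'rV[R]_n) : \bar R :=
  limf_einf
    (fun p : R * 'rV[R]_n =>
      (phi (x + p.1 *: p.2)%R - phi x - (p.1 * dot v p.2)%:E)
        * ((2^-1 * p.1 ^+ 2)^-1)%:E)%E
    (filter_prod (0 : R)^'+ (nbhs w)).

(* Tangency of [w] at [z] is not required separately: it follows as soon as the
   set below is nonempty. *)
Definition second_order_tangent_set {R : realType} {V : normedModType R}
    (Omega : set V) (z w : V) : set V :=
  [set u | exists (t : nat -> R) (s : nat -> V),
    [/\ forall k, 0 < t k, t @ \oo --> (0 : R), s @ \oo --> u &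
      forall k, Omega (z + t k *: w + (2^-1 * t k ^+ 2) *: s k)]].

(* Main.v *)
Require Import Defs.
From HB Require Import structures.
From mathcomp Require Import all_boot all_order all_algebra.
From mathcomp Require Import all_classical all_reals all_analysis.
From mathcomp Require Import ring lra.

Import Order.TTheory GRing.Theory Num.Theory.
Import numFieldNormedType.Exports.

Local Open Scope classical_set_scope.
Local Open Scope ring_scope.

(** Write c for the finite value of phi at xbar, and v for vbar. A real a lies
    below one of the two lower limits when, for small t > 0 and u close to w,
    the function phi satisfies a growth condition of first or second order:
    [c + a * t <= phi (xbar + t *: u)] for the subderivative and
    [c + t * dot v u + a * (t ^+ 2 / 2) <= phi (xbar + t *: u)] for the second
    subderivative. The lemmas [subderivative_lt], [subderivative_ge],
    [second_subderivative_lt] and [second_subderivative_ge] record these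
    translations, up to the usual difference between strict and large
    inequalities, and reduce the rest to inequalities between reals.

    Lower semicontinuity holds for every lower limit taken over
    [filter_prod G (nbhs w)], because a neighbourhood of w is a neighbourhood
    of all points close to w ([limf_einf_lower_semicontinuous]). The proximal
    inequality, read at the point xbar + t *: u, is the second-order growth
    condition with a = - r * |u|^2; letting u tend to w gives the quadratic
    lower bound, which excludes the value -oo. Properness then only needs
    one point of finite value, and at w = 0 the difference quotient vanishes
    for the choice u = 0.

    For the domain formula, the proximal inequality also gives
    [dot v w <= subderivative phi xbar w]. If this inequality is strict, then
    phi exceeds c + t * dot v u by a positive multiple of t, which dominates
    every multiple of t ^+ 2, so the second subderivative is +oo. If it is an
    equality, a second-order tangent (u, alpha) to the epigraph provides
    points xbar + t_k *: w_k with w_k = w + (t_k / 2) *: u_k tending to w,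
    along which the second-order quotient is at most
    alpha_k - dot v u_k; the latter converges, so the lower limit is
    finite. *)

(** * Lower limits along a filter *)

Lemma limf_einf_lt {R : realType} {X : nbhsType} (F : set_system X)
    (FF : Filter F) (f : X -> \bar R) (a : \bar R) :
  (a < limf_einf f F)%E -> \forall x \near F, (a < f x)%E.
Proof.
rewrite limf_einfE => /ereal_sup_gt[_ [V FV <-]] aV.
apply: filterS FV => x Vx; apply: (lt_le_trans aV).
by apply: ereal_inf_lbound; exists x.
Qed.

Lemma limf_einf_ge {R : realType} {X : nbhsType} (F : set_system X)
    (f : X -> \bar R) (a : \bar R) :
  (\forall x \near F, (a <= f x)%E) -> (a <= limf_einf f F)%E.
Proof.
move=> Fa; rewrite limf_einfE; apply: le_ereal_sup_tmp.
exists (ereal_inf (f @` [set x | (a <= f x)%E])).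
  by exists [set x | (a <= f x)%E].
by apply: le_ereal_inf_tmp => _ [x /= ax <-].
Qed.

Lemma lte_realP {R : realType} (a : R) (x : \bar R) :
  (a%:E < x)%E -> exists2 b : R, a < b & (b%:E < x)%E.
Proof.
case: x => [x| |] //=.
- by rewrite lte_fin => ax; exists ((a + x) / 2); rewrite ?lte_fin; lra.
- by move=> _; exists (a + 1); rewrite ?ltry//; lra.
Qed.

Lemma lee_realP {R : realType} (b : R) (x : \bar R) :
  (forall a : R, a < b -> (a%:E <= x)%E) -> (b%:E <= x)%E.
Proof.
move=> h; apply/lee_subgt0Pr => e e0.
by rewrite -EFinB; apply: h; lra.
Qed.

(** A strict lower bound near (0, w) holds on a product of a set of the first
    filter with an open neighbourhood of w, which serves every nearby point. *)
Lemma limf_einf_lower_semicontinuous {R : realType} {T : nbhsType}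
    {X : topologicalType} (G : set_system T) (FG : Filter G)
    (f : T * X -> \bar R) :
  lower_semicontinuous (fun w => limf_einf f (filter_prod G (nbhs w))).
Proof.
move=> w a /lte_realP[b ab /limf_einf_lt -[[P Q] /= [GP wQ] PQ]].
exists Q°%classic; first exact: nbhs_interior.
move=> y Qy; apply: (@lt_le_trans _ _ b%:E); first by rewrite lte_fin.
apply: limf_einf_ge; exists (P, Q) => //= -[t u] /PQ /=; exact: ltW.
Qed.

(** * Difference quotients as growth conditions *)

Lemma lee_quotient {R : realType} (y : \bar R) (a c l k : R) (k0 : 0 < k) :
  (a%:E <= (y - c%:E - l%:E) * (k^-1)%:E)%E = ((c + l + a * k)%:E <= y)%E.
Proof.
rewrite lee_pdivlMr// !leeBrDr//= -!EFinM -!EFinD.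
by congr (_%:E <= _)%E; ring.
Qed.

Lemma lte_quotient {R : realType} (y : \bar R) (a c l k : R) (k0 : 0 < k) :
  (a%:E < (y - c%:E - l%:E) * (k^-1)%:E)%E = ((c + l + a * k)%:E < y)%E.
Proof.
rewrite lte_pdivlMr// !lteBrDr//= -!EFinM -!EFinD.
by congr (_%:E < _)%E; ring.
Qed.

Lemma near_fst_gt0 {R : realType} {X : Type} (G : set_system X)
    (FG : Filter G) :
  \forall p \near filter_prod (0 : R)^'+ G, 0 < p.1.
Proof. exact: (cvg_fst (nbhs_right_gt (0 : R))). Qed.

Lemma subderivative_lt {R : realType} {n : nat} (phi : 'rV[R]_n -> \bar R)
    (x w : 'rV[R]_n) (c a : R) (phix : phi x = c%:E) :
  (a%:E < subderivative phi x w)%E ->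
  \forall p \near filter_prod (0 : R)^'+ (nbhs w),
    ((c + a * p.1)%:E < phi (x + p.1 *: p.2)%R)%E.
Proof.
move=> /limf_einf_lt h; near=> p.
have p0 : 0 < p.1 by near: p; exact: near_fst_gt0.
have : (a%:E < (phi (x + p.1 *: p.2)%R - phi x) * (p.1^-1)%:E)%E by near: p.
by rewrite phix -[X in (X * _)%E]sube0 lte_quotient// addr0.
Unshelve. all: by end_near. Qed.

Lemma subderivative_ge {R : realType} {n : nat} (phi : 'rV[R]_n -> \bar R)
    (x w : 'rV[R]_n) (c a : R) (phix : phi x = c%:E) :
  (\forall p \near filter_prod (0 : R)^'+ (nbhs w),
    ((c + a * p.1)%:E <= phi (x + p.1 *: p.2)%R)%E) ->
  (a%:E <= subderivative phi x w)%E.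
Proof.
move=> h; apply: limf_einf_ge; near=> p.
have p0 : 0 < p.1 by near: p; exact: near_fst_gt0.
rewrite phix -[X in (X * _)%E]sube0 lee_quotient// addr0.
by near: p.
Unshelve. all: by end_near. Qed.

Lemma second_subderivative_lt {R : realType} {n : nat}
    (phi : 'rV[R]_n -> \bar R) (x v w : 'rV[R]_n) (c a : R)
    (phix : phi x = c%:E) :
  (a%:E < second_subderivative phi x v w)%E ->
  \forall p \near filter_prod (0 : R)^'+ (nbhs w),
    ((c + p.1 * dot v p.2 + a * (2^-1 * p.1 ^+ 2))%:E
      < phi (x + p.1 *: p.2)%R)%E.
Proof.
move=> /limf_einf_lt h; near=> p.
have p0 : 0 < p.1 by near: p; exact: near_fst_gt0.
rewrite -lte_quotient; last by rewrite mulr_gt0 ?exprn_gt0 ?invr_gt0.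
by rewrite -phix; near: p.
Unshelve. all: by end_near. Qed.

Lemma second_subderivative_ge {R : realType} {n : nat}
    (phi : 'rV[R]_n -> \bar R) (x v w : 'rV[R]_n) (c a : R)
    (phix : phi x = c%:E) :
  (\forall p \near filter_prod (0 : R)^'+ (nbhs w),
    ((c + p.1 * dot v p.2 + a * (2^-1 * p.1 ^+ 2))%:E
      <= phi (x + p.1 *: p.2)%R)%E) ->
  (a%:E <= second_subderivative phi x v w)%E.
Proof.
move=> h; apply: limf_einf_ge; near=> p.
have p0 : 0 < p.1 by near: p; exact: near_fst_gt0.
rewrite phix lee_quotient; last by rewrite mulr_gt0 ?exprn_gt0 ?invr_gt0.
by near: p.
Unshelve. all: by end_near. Qed.

(** * Euclidean inner product *)

Lemma dotDr {R : realType} {n : nat} (u v w : 'rV[R]_n) :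
  dot u (v + w) = dot u v + dot u w.
Proof.
by rewrite /dot -big_split; apply: eq_bigr => i _; rewrite mxE mulrDr.
Qed.

Lemma dotZr {R : realType} {n : nat} (a : R) (u v : 'rV[R]_n) :
  dot u (a *: v) = a * dot u v.
Proof.
by rewrite /dot mulr_sumr; apply: eq_bigr => i _; rewrite mxE mulrCA.
Qed.

Lemma dotZl {R : realType} {n : nat} (a : R) (u v : 'rV[R]_n) :
  dot (a *: u) v = a * dot u v.
Proof.
by rewrite /dot mulr_sumr; apply: eq_bigr => i _; rewrite mxE mulrA.
Qed.

Lemma enorm_sqr {R : realType} {n : nat} (u : 'rV[R]_n) :
  enorm u ^+ 2 = dot u u.
Proof.
by rewrite sqr_sqrtr//; apply: sumr_ge0 => i _; rewrite -expr2 sqr_ge0.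
Qed.

Lemma cvg_dot {R : realType} {n : nat} {T : Type} (F : set_system T)
    (FF : Filter F) (f g : T -> 'rV[R]_n) (a b : 'rV[R]_n) :
  f @ F --> a -> g @ F --> b -> dot (f x) (g x) @[x --> F] --> dot a b.
Proof.
move=> fa gb; apply: cvg_big => [|i _]; first exact: add_continuous.
apply: cvgM.
- exact: (cvg_comp _ _ fa (coord_continuous (i := 0) (j := i) (x := a))).
- exact: (cvg_comp _ _ gb (coord_continuous (i := 0) (j := i) (x := b))).
Qed.

Lemma cvg_fst_right {R : realType} {X : Type} (G : set_system X)
    (FG : Filter G) :
  p.1 @[p --> filter_prod (0 : R)^'+ G] --> (0 : R).
Proof. exact: (cvg_trans cvg_fst (@cvg_within _ (nbhs (0 : R)) _ _)). Qed.

Lemma cvg_snd_nbhs {R : realType} {X : topologicalType} (w : X) :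
  p.2 @[p --> filter_prod (0 : R)^'+ (nbhs w)] --> w.
Proof. exact: cvg_snd. Qed.

(** * Consequences of the proximal inequality *)

(** The point x + t *: u enters the ball where the proximal inequality is
    assumed as soon as t is small, uniformly for u near w. *)
Lemma proximal_growth {R : realType} {n : nat} (phi : 'rV[R]_n -> \bar R)
    (x v w : 'rV[R]_n) (c gamma r : R) (phix : phi x = c%:E)
    (gamma0 : 0 < gamma)
    (prox : forall y, enorm (y - x) <= gamma ->
      (phi x + (dot v (y - x) - r / 2 * enorm (y - x) ^+ 2)%:E <= phi y)%E) :
  \forall p \near filter_prod (0 : R)^'+ (nbhs w),
    ((c + p.1 * dot v p.2 + (- r * dot p.2 p.2) * (2^-1 * p.1 ^+ 2))%:E
      <= phi (x + p.1 *: p.2)%R)%E.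
Proof.
have small : p.1 * (p.1 * dot p.2 p.2)
    @[p --> filter_prod (0 : R)^'+ (nbhs w)] --> 0 * (0 * dot w w).
  apply: cvgM; first exact: cvg_fst_right.
  apply: cvgM; first exact: cvg_fst_right.
  by apply: cvg_dot; exact: cvg_snd_nbhs.
rewrite mul0r in small.
near=> p.
have : enorm (x + p.1 *: p.2 - x) <= gamma.
  rewrite addrAC subrr add0r -(@ler_pXn2r _ 2)//;
    rewrite ?nnegrE ?sqrtr_ge0 ?(ltW gamma0)//.
  rewrite enorm_sqr dotZr dotZl.
  by near: p; apply: (cvgr_le _ small); rewrite exprn_gt0.
move=> /prox; rewrite phix enorm_sqr (addrAC x) subrr add0r !dotZr dotZl.
rewrite -EFinD; apply: le_trans; rewrite lee_fin le_eqVlt.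
by apply/orP; left; apply/eqP; field.
Unshelve. all: by end_near. Qed.

Lemma proximal_second_subderivative_ge {R : realType} {n : nat}
    (phi : 'rV[R]_n -> \bar R) (x v : 'rV[R]_n) (c : R)
    (phix : phi x = c%:E) (prox : proximal_subdifferential phi x v) :
  exists2 r : R, 0 < r &
    forall w, ((- r * enorm w ^+ 2)%:E <= second_subderivative phi x v w)%E.
Proof.
case: prox => gamma [r [gamma0 r0 prox]]; exists r => // w.
rewrite enorm_sqr; apply: lee_realP => a aw.
apply: (second_subderivative_ge _ _ _ _ c) => //.
have lim : - r * dot p.2 p.2
    @[p --> filter_prod (0 : R)^'+ (nbhs w)] --> - r * dot w w.
  apply: cvgM; first exact: cvg_cst.
  by apply: cvg_dot; exact: cvg_snd_nbhs.
near=> p.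
have p0 : 0 < p.1 by near: p; exact: near_fst_gt0.
have aru : a <= - r * dot p.2 p.2 by near: p; exact: (cvgr_ge _ lim).
apply: (@le_trans _ _
  (c + p.1 * dot v p.2 + (- r * dot p.2 p.2) * (2^-1 * p.1 ^+ 2))%:E).
  by rewrite lee_fin lerD2l ler_wpM2r// mulr_ge0 ?sqr_ge0 ?invr_ge0.
by near: p; exact: proximal_growth phix gamma0 prox.
Unshelve. all: by end_near. Qed.

Lemma proximal_subderivative_ge {R : realType} {n : nat}
    (phi : 'rV[R]_n -> \bar R) (x v w : 'rV[R]_n) (c : R)
    (phix : phi x = c%:E) (prox : proximal_subdifferential phi x v) :
  ((dot v w)%:E <= subderivative phi x w)%E.
Proof.
case: prox => gamma [r [gamma0 r0 prox]].
apply: lee_realP => a aw; apply: (subderivative_ge _ _ _ c) => //.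
have lim : dot v p.2 + p.1 * (- r / 2 * dot p.2 p.2)
    @[p --> filter_prod (0 : R)^'+ (nbhs w)]
    --> dot v w + 0 * (- r / 2 * dot w w).
  apply: cvgD; first by apply: cvg_dot; [exact: cvg_cst|exact: cvg_snd_nbhs].
  apply: cvgM; first exact: cvg_fst_right.
  apply: cvgM; first exact: cvg_cst.
  by apply: cvg_dot; exact: cvg_snd_nbhs.
rewrite mul0r addr0 in lim.
near=> p.
have p0 : 0 < p.1 by near: p; exact: near_fst_gt0.
have aru : a <= dot v p.2 + p.1 * (- r / 2 * dot p.2 p.2).
  by near: p; exact: (cvgr_ge _ lim).
apply: (@le_trans _ _
  (c + p.1 * dot v p.2 + (- r * dot p.2 p.2) * (2^-1 * p.1 ^+ 2))%:E).
  rewrite lee_fin -addrA lerD2l -(ler_pM2r p0) in aru *.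
  by apply: (le_trans aru); rewrite le_eqVlt; apply/orP; left; apply/eqP; field.
by near: p; exact: proximal_growth phix gamma0 prox.
Unshelve. all: by end_near. Qed.

(** * The second subderivative at particular directions *)

(** The choice u = 0 is allowed in the lower limit at w = 0 and makes the
    quotient vanish for every t. *)
Lemma second_subderivative0_le0 {R : realType} {n : nat}
    (phi : 'rV[R]_n -> \bar R) (x v : 'rV[R]_n) (c : R)
    (phix : phi x = c%:E) :
  (second_subderivative phi x v 0 <= 0)%E.
Proof.
rewrite leNgt; apply/negP => /(second_subderivative_lt _ _ _ _ c _ phix).
move=> h.
have zero : ((t, 0 : 'rV[R]_n) @[t --> (0 : R)^'+]
    --> filter_prod (0 : R)^'+ (nbhs (0 : 'rV[R]_n))).
  exact: (cvg_pair (@cvg_id _ _) (@cvg_cst _ (0 : 'rV[R]_n) _ _ _)).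
have /(@filter_ex _ (0 : R)^'+ _)[t /=] := zero _ h.
by rewrite scaler0 addr0 phix -(scale0r 0) dotZr !(mul0r, mulr0) !addr0 ltxx.
Qed.

(** If the first-order increment exceeds t * dot v u by e * t, then it exceeds
    t * dot v u + a * t ^+ 2 / 2 for every a, once t is small. *)
Lemma second_subderivative_pinfty {R : realType} {n : nat}
    (phi : 'rV[R]_n -> \bar R) (x v w : 'rV[R]_n) (c : R)
    (phix : phi x = c%:E) :
  ((dot v w)%:E < subderivative phi x w)%E ->
  second_subderivative phi x v w = +oo%E.
Proof.
move=> /lte_realP[b vwb /(subderivative_lt _ _ _ c _ phix) h].
apply: eq_infty => a; apply: (second_subderivative_ge _ _ _ _ c) => //.
have lim : dot v p.2 + p.1 * (a / 2)
    @[p --> filter_prod (0 : R)^'+ (nbhs w)] --> dot v w + 0 * (a / 2).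
  apply: cvgD; first by apply: cvg_dot; [exact: cvg_cst|exact: cvg_snd_nbhs].
  by apply: cvgM; [exact: cvg_fst_right|exact: cvg_cst].
rewrite mul0r addr0 in lim.
near=> p.
have p0 : 0 < p.1 by near: p; exact: near_fst_gt0.
have vab : dot v p.2 + p.1 * (a / 2) <= b by near: p; exact: (cvgr_le _ lim).
apply: (@le_trans _ _ (c + b * p.1)%:E).
  rewrite lee_fin -addrA lerD2l -(ler_pM2r p0) in vab *.
  by apply: le_trans vab; rewrite le_eqVlt; apply/orP; left; apply/eqP; field.
by apply: ltW; near: p.
Unshelve. all: by end_near. Qed.

(** The tangent set provides points of the epigraph whose height is
    c + t_k * dot v w up to a term of order t_k ^+ 2. The first-order term
    cancels in the second-order quotient, which therefore stays bounded
    above. *)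
Lemma second_subderivative_lt_pinfty {R : realType} {n : nat}
    (phi : 'rV[R]_n -> \bar R) (x v w : 'rV[R]_n) (c : R)
    (phix : phi x = c%:E) :
  second_order_tangent_set (epigraph phi) (x, c) (w, dot v w) !=set0 ->
  (second_subderivative phi x v w < +oo)%E.
Proof.
move=> [[u alpha] [t [s [t0 tcvg scvg epi]]]].
have s1 : (s k).1 @[k --> \oo] --> u by exact: (cvg_comp _ _ scvg cvg_fst).
have s2 : (s k).2 @[k --> \oo] --> alpha by exact: (cvg_comp _ _ scvg cvg_snd).
rewrite ltey; apply/negP => /eqP d2y.
(* The quotients are at most [(s k).2 - dot v (s k).1], which tends to
   [alpha - dot v u]; any larger number, here with 1 added, bounds them. *)
have /(second_subderivative_lt _ _ _ _ c _ phix) h :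
    ((alpha - dot v u + 1)%:E < second_subderivative phi x v w)%E.
  by rewrite d2y ltry.
(* The second-order term is absorbed into the direction. *)
pose wk k := w + (2^-1 * t k) *: (s k).1.
have wkw : wk @ \oo --> w.
  rewrite -[X in _ --> X]addr0 -(scale0r u) -(mulr0 2^-1).
  apply: cvgD; first exact: cvg_cst.
  by apply: cvgZ => //; apply: cvgM => //; exact: cvg_cst.
have tr : t @ \oo --> (0 : R)^'+.
  move=> A; rewrite /at_right /within /= => /tcvg.
  apply: (@filterS _ \oo) => k /=.
  by apply; exact: t0.
have slope : (s k).2 - dot v (s k).1 @[k --> \oo] --> alpha - dot v u.
  by apply: cvgB => //; apply: cvg_dot => //; exact: cvg_cst.
have above : \forall k \near \oo,
    ((c + t k * dot v (wk k) + (alpha - dot v u + 1) * (2^-1 * t k ^+ 2))%:E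
      < phi (x + t k *: wk k)%R)%E by exact: (cvg_pair tr wkw h).
have below : \forall k \near \oo,
    (s k).2 - dot v (s k).1 < alpha - dot v u + 1.
  by apply: (cvgr_lt _ slope); rewrite ltrDl.
have [k [abovek belowk]] := filter_ex (filterI above below).
have wkE : x + t k *: w + (2^-1 * t k ^+ 2) *: (s k).1 = x + t k *: wk k.
  by rewrite -addrA /wk scalerDr scalerA; congr (_ + (_ + _ *: _)); ring.
have epik : (phi (x + t k *: wk k)%R
    <= (c + t k * dot v w + (2^-1 * t k ^+ 2) * (s k).2)%:E)%E.
  by rewrite -wkE; exact: epi.
have := lt_le_trans abovek epik; rewrite lte_fin /wk dotDr dotZr.
have : 0 < 2^-1 * t k ^+ 2 by rewrite mulr_gt0 ?invr_gt0 ?exprn_gt0.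
move=> /ltr_pM2r h2; rewrite -h2 in belowk.
by lra.
Qed.

Theorem theorem4p1 (R : realType) (n : nat) (phi : 'rV[R]_n -> \bar R)
    (xbar vbar : 'rV[R]_n)
    (phi_neqNy : forall x, phi x != -oo%E)
    (xbar_dom : edom phi xbar)
    (vbar_prox : proximal_subdifferential phi xbar vbar) :
  [/\ lower_semicontinuous (second_subderivative phi xbar vbar),
      exists2 r : R, 0 < r &
        forall w, ((- r * enorm w ^+ 2)%:E
                   <= second_subderivative phi xbar vbar w)%E
    & eproper (second_subderivative phi xbar vbar)]
  /\
  ((forall w, subderivative phi xbar w = (dot vbar w)%:E ->
      second_order_tangent_set (epigraph phi) (xbar, fine (phi xbar))
        (w, fine (subderivative phi xbar w)) !=set0) ->
   edom (second_subderivative phi xbar vbar)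
     = [set w | subderivative phi xbar w = (dot vbar w)%:E]).
Proof.
have phix : phi xbar = (fine (phi xbar))%:E.
  by rewrite fineK// fin_numE phi_neqNy -ltey.
have bound := proximal_second_subderivative_ge _ _ _ _ phix vbar_prox.
split.
  split=> //; first exact: limf_einf_lower_semicontinuous.
  split=> [w|].
    case: bound => r _ /(_ w) /(lt_le_trans (ltNyr _)).
    by rewrite lt_neqAle eq_sym => /andP[].
  exists 0; apply: (le_lt_trans _ (ltry 0)).
  exact: second_subderivative0_le0 phix.
move=> tangent; apply/seteqP; split=> w.
- move=> /= d2w; apply/eqP; rewrite eq_le.
  rewrite (proximal_subderivative_ge _ _ _ _ _ phix vbar_prox) andbT leNgt.
  apply/negP => /(second_subderivative_pinfty _ _ _ _ _ phix) d2y.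
  by move: d2w; rewrite /edom /= d2y ltxx.
- move=> /= dw; apply: (second_subderivative_lt_pinfty _ _ _ _ _ phix).
  by have := tangent _ dw; rewrite dw.
Qed.
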